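(* Let $G$ be a connected graph and $k$ a positive integer. Then $G$ admits a strongly $k$-uniform integer additive set-indexer if and only if $G$ is bipartite or $G$ admits a $(k,l)$-completely uniform integer additive set-indexer with $k=l^2$.
   Context: All graphs are simple, finite and have no isolated vertices. Set-labels are non-empty finite subsets of the non-negative integers $\mathbb{N}_0$. For sets $A,B$, $A+B=\{a+b: a\in A, b\in B\}$. An integer additive set-indexer (IASI) of $G$ is an injective $f:V(G)\to 2^{\mathbb{N}_0}$ such that $f^+:E(G)\to 2^{\mathbb{N}_0}$, $f^+(uv)=f(u)+f(v)$, is injective. An IASI is $k$-uniform if $|f^+(e)|=k$ for all edges $e$. It is strong if $|f^+(uv)|=|f(u)|\,|f(v)|$ for every edge $uv$, and strongly $k$-uniform if it is strong and $k$-uniform. An IASI $f$ is $(k,l)$-completely uniform if it is $k$-uniform and $|f(v)|=l$ for every vertex $v$. *)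

(* Defs.v *)
From HB Require Import structures.
From mathcomp Require Import all_boot finmap.

Set Implicit Arguments.
Unset Strict Implicit.
Unset Printing Implicit Defensive.

Local Open Scope fset_scope.
Local Open Scope nat_scope.

Record sgraph := SGraph {
  vertex :> finType;
  adj : rel vertex;
  adj_sym : symmetric adj;
  adj_irrefl : irreflexive adj }.

Definition no_isolated (G : sgraph) : Prop :=
  forall u : G, exists v : G, adj u v.

Definition connected_graph (G : sgraph) : Prop :=
  0 < #|G| /\ forall u v : G, connect (@adj G) u v.

Definition bipartite (G : sgraph) : Prop :=
  exists A : {set G}, forall u v : G, adj u v -> (u \in A) != (v \in A).

Definition sumset (A B : {fset nat}) : {fset nat} :=
  [fset a + b | a in A, b in B].

Section Labellings.

Variables (G : sgraph) (f : G -> {fset nat}).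

(* The label f^+(uv); it is symmetric in u and v, so it depends only on the
   edge uv. *)
Definition edge_label (u v : G) : {fset nat} := sumset (f u) (f v).

(* The edge uv is identified with the unordered pair [set u; v], so the last
   clause is injectivity of f^+ on E(G). *)
Definition iasi : Prop :=
  [/\ forall v : G, f v != fset0,
      injective f
    & forall u v x y : G, adj u v -> adj x y ->
        edge_label u v = edge_label x y -> [set u; v] = [set x; y]].

Definition uniform_iasi (k : nat) : Prop :=
  iasi /\ forall u v : G, adj u v -> #|` edge_label u v| = k.

Definition strong_iasi : Prop :=
  iasi /\
  forall u v : G, adj u v -> #|` edge_label u v| = #|` f u| * #|` f v|.

Definition strongly_uniform_iasi (k : nat) : Prop :=
  strong_iasi /\ uniform_iasi k.

Definition completely_uniform_iasi (k l : nat) : Prop :=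
  uniform_iasi k /\ forall v : G, #|` f v| = l.

End Labellings.

(* Main.v *)
Require Import Defs.
From HB Require Import structures.
From mathcomp Require Import all_boot finmap.
From mathcomp Require Import zify.

Set Implicit Arguments.
Unset Strict Implicit.
Unset Printing Implicit Defensive.

Local Open Scope nat_scope.

(** Along an edge uv of a strongly k-uniform labelling |f u| |f v| = k, so the
    size of the label at one end determines the size at the other. In a
    connected graph at most two sizes therefore occur: if they differ, they
    alternate along edges and give a bipartition; if only one size l occurs,
    then k = l^2 and f is completely uniform.
    Conversely, label one side of a bipartite graph by singletons and the other
    by intervals of length k. Edge labels are then intervals of length k, and
    they are distinct as soon as the least elements of the vertex labels have
    distinct pairwise sums, for instance if these are distinct powers of 2. *)

Lemma sumsetP (A B : {fset nat}) x :
  reflect (exists a b, [/\ a \in A, b \in B & x = a + b]) (x \in sumset A B).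
Proof.
apply: (iffP idP) => [/imfset2P [a /= aA [b /= bB ->]]|[a [b [aA bB ->]]]].
  by exists a, b.
by apply/imfset2P; exists a => //; exists b.
Qed.

Definition interval_fset (a n : nat) : {fset nat} := [fset x in iota a n]%fset.

Lemma in_interval_fset a n x : (x \in interval_fset a n) = (a <= x < a + n).
Proof. by rewrite in_fset_ /= mem_iota. Qed.

Lemma card_interval_fset a n : #|` interval_fset a n| = n.
Proof. by rewrite card_fseq undup_id ?iota_uniq // size_iota. Qed.

Lemma interval_fset_start_inj a b m n :
  0 < m -> interval_fset a m = interval_fset b n -> a = b.
Proof.
move=> m_gt0 /fsetP eq_ab; have := eq_ab a; have := eq_ab b.
rewrite !in_interval_fset; lia.
Qed.

Lemma sumset_interval_fset a b m n : 0 < m -> 0 < n ->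
  sumset (interval_fset a m) (interval_fset b n) =
    interval_fset (a + b) (m + n).-1.
Proof.
move=> m_gt0 n_gt0; apply/fsetP => x; rewrite in_interval_fset.
apply/sumsetP/idP => [[y [z []]]|x_ab]; first by rewrite !in_interval_fset; lia.
exists (minn (x - b) (a + m.-1)), (x - minn (x - b) (a + m.-1)).
by rewrite !in_interval_fset; split; lia.
Qed.

Definition weak_sidon (T : finType) (c : T -> nat) : Prop :=
  forall u v x y, u != v -> x != y -> c u + c v = c x + c y ->
    [set u; v] = [set x; y].

Lemma trunc_log_add_expn p i j :
  1 < p -> i < j -> trunc_log p (p ^ i + p ^ j) = j.
Proof.
move=> p_gt1 ij; apply: trunc_log_eq => //; rewrite leq_addl /= expnS.
have : p ^ i < p ^ j by rewrite ltn_exp2l.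
have : 2 * p ^ j <= p * p ^ j by rewrite leq_mul2r p_gt1 orbT.
lia.
Qed.

Lemma add_expn_inj p i j x y : 1 < p -> i < j -> x < y ->
  p ^ i + p ^ j = p ^ x + p ^ y -> i = x /\ j = y.
Proof.
move=> p_gt1 ij xy eq_sum.
have jy : j = y.
  by rewrite -(trunc_log_add_expn p_gt1 ij) eq_sum trunc_log_add_expn.
by split=> //; move: eq_sum; rewrite jy => /addIn/(expnI p_gt1).
Qed.

Lemma weak_sidon_expn (T : finType) p (r : T -> nat) :
  1 < p -> injective r -> weak_sidon (fun v => p ^ r v).
Proof.
move=> p_gt1 r_inj u v x y.
wlog uv : u v / r u < r v => [sorted_uv uDv|_].
  have [uv|vu|/r_inj/eqP] := ltngtP (r u) (r v); last by rewrite (negbTE uDv).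
    exact: sorted_uv.
  by rewrite addnC setUC; apply: sorted_uv; rewrite // eq_sym.
wlog xy : x y / r x < r y => [sorted_xy xDy|_].
  have [xy|yx|/r_inj/eqP] := ltngtP (r x) (r y); last by rewrite (negbTE xDy).
    exact: sorted_xy.
  rewrite (addnC (p ^ r x)) (setUC [set x]).
  by apply: sorted_xy; rewrite // eq_sym.
by move=> /(add_expn_inj p_gt1 uv xy) [/r_inj -> /r_inj ->].
Qed.

Section IntervalLabelling.

Variables (G : sgraph) (c s : G -> nat).
Hypothesis s_gt0 : forall v, 0 < s v.

Definition interval_labelling (v : G) : {fset nat} := interval_fset (c v) (s v).

Lemma edge_label_interval u v :
  edge_label interval_labelling u v =
    interval_fset (c u + c v) (s u + s v).-1.
Proof. exact: sumset_interval_fset. Qed.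

Lemma interval_labelling_iasi :
  injective c -> weak_sidon c -> iasi interval_labelling.
Proof.
have adj_neq (u v : G) : adj u v -> u != v.
  by apply: contraTneq => ->; rewrite adj_irrefl.
move=> c_inj c_sidon; split=> [v|u v|u v x y uv xy].
- by rewrite -cardfs_gt0 card_interval_fset.
- by move=> /(interval_fset_start_inj (s_gt0 u))/c_inj.
- rewrite !edge_label_interval => /interval_fset_start_inj eq_start.
  apply: c_sidon; rewrite ?adj_neq // eq_start //.
  by have := s_gt0 u; have := s_gt0 v; lia.
Qed.

End IntervalLabelling.

Lemma bipartite_strongly_uniform (G : sgraph) (k : nat) : 0 < k ->
  bipartite G -> exists f : G -> {fset nat}, strongly_uniform_iasi f k.
Proof.
move=> k_gt0 [A bipA].
pose c (v : G) := 2 ^ choice.pickle v.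
pose s (v : G) := if v \in A then 1 else k.
have pickle_inj : injective (@choice.pickle G) :=
  pcan_inj (@choice.pickleK G).
have s_gt0 v : 0 < s v by rewrite /s; case: ifP.
have s_edge u v : adj u v -> (s u + s v).-1 = k /\ s u * s v = k.
  by move=> /bipA; rewrite /s; case: (u \in A); case: (v \in A) => // _; lia.
have f_iasi : iasi (interval_labelling c s).
  apply: interval_labelling_iasi => //; last exact: weak_sidon_expn.
  by move=> u v /(expnI (ltnSn 1))/pickle_inj.
exists (interval_labelling c s).
split; split=> // u v /s_edge [card_sum card_mul];
  by rewrite edge_label_interval // !card_interval_fset card_sum.
Qed.

Section EdgeDetermined.

Variables (G : sgraph) (T : eqType) (g : G -> T).

Definition edge_determined : Prop :=
  forall u v x y : G, adj u v -> adj x y -> g u = g x -> g v = g y.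

Hypotheses (G_conn : connected_graph G) (g_det : edge_determined).

Lemma edge_determined_two_values (r w v : G) :
  adj r w -> g v \in [:: g r; g w].
Proof.
move=> rw; pose A := [pred x | g x \in [:: g r; g w]].
have A_closed : closed (@adj G) A.
  apply: (intro_closed (sym_connect_sym (@adj_sym G))) => x y xy.
  rewrite !inE => /orP[] /eqP gx.
    by rewrite (g_det xy rw gx) eqxx orbT.
  by rewrite (g_det xy _ gx (y := r)) ?eqxx // adj_sym.
by have := closed_connect A_closed (G_conn.2 r v); rewrite !inE eqxx => <-.
Qed.

Lemma edge_determined_bipartite_or_constant (r w : G) :
  adj r w -> bipartite G \/ forall v, g v = g r.
Proof.
move=> rw; have g_rw v := edge_determined_two_values v rw.
have [eq_wr|wDr] := eqVneq (g w) (g r).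
  by right=> v; have := g_rw v; rewrite eq_wr !inE orbb => /eqP.
left; exists [set v | g v == g r] => u v uv; rewrite !inE.
have := g_rw u; rewrite !inE => /orP[] /eqP gu.
  by rewrite gu (g_det uv rw gu) eqxx (negbTE wDr).
have -> : g v = g r by apply: g_det uv _ gu; rewrite adj_sym.
by rewrite gu eqxx (negbTE wDr).
Qed.

End EdgeDetermined.

Section LabelSizes.

Variables (G : sgraph) (f : G -> {fset nat}).

Lemma strongly_uniform_card_mul k u v :
  strongly_uniform_iasi f k -> adj u v -> #|` f u| * #|` f v| = k.
Proof. by case=> [[_ f_strong] [_ f_unif]] uv; rewrite -f_strong ?f_unif. Qed.

Lemma strongly_uniform_card_edge_determined k :
  0 < k -> strongly_uniform_iasi f k ->
  edge_determined (fun v => #|` f v|).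
Proof.
move=> k_gt0 f_su u v x y /(strongly_uniform_card_mul f_su) mul_uv.
move=> /(strongly_uniform_card_mul f_su) mul_xy eq_ux.
have x_gt0 : 0 < #|` f x| by move: k_gt0; rewrite -mul_xy muln_gt0 => /andP[].
by apply/eqP; rewrite -(eqn_pmul2l x_gt0) mul_xy -eq_ux mul_uv.
Qed.

Lemma completely_uniform_strongly_uniform l :
  completely_uniform_iasi f (l ^ 2) l -> strongly_uniform_iasi f (l ^ 2).
Proof.
case=> [[f_iasi f_unif] card_f].
by do 2!split=> //; move=> u v uv; rewrite f_unif // !card_f mulnn.
Qed.

End LabelSizes.

Theorem theorem8 (G : sgraph) (k : nat) :
  no_isolated G -> connected_graph G -> 0 < k ->
  ((exists f : G -> {fset nat}, strongly_uniform_iasi f k) <->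
   (bipartite G \/
    exists l : nat, k = l ^ 2 /\
      exists f : G -> {fset nat}, completely_uniform_iasi f k l)).
Proof.
move=> no_iso G_conn k_gt0; split; last first.
  case=> [|[l [-> [f f_cu]]]]; first exact: bipartite_strongly_uniform.
  by exists f; apply: completely_uniform_strongly_uniform.
case=> f f_su; have [/card_gt0P[r _] _] := G_conn; have [w rw] := no_iso r.
have f_det := strongly_uniform_card_edge_determined k_gt0 f_su.
have [|card_f] := edge_determined_bipartite_or_constant G_conn f_det rw.
  by left.
right; exists #|` f r|; split; last by exists f; split=> //; case: f_su.
by rewrite -(strongly_uniform_card_mul f_su rw) card_f mulnn.
Qed.
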